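(* Let $\alpha:I\to\mathbb{I}^3$ be an admissible $C^4$ regular unit speed curve in simply isotropic space, with an RM frame $\{\mathbf t,\mathbf n_1,\mathbf n_2=\mathbf b\}$ and natural curvatures $\kappa_1,\kappa_2$. Then $\alpha$ lies on the surface of a simply isotropic sphere if and only if its normal development, i.e. the plane curve $s\mapsto(\kappa_1(s),\kappa_2(s))$, lies on a line of $\mathbb{R}^2$ not passing through the origin. In addition, $\alpha$ is a spherical curve of cylindrical type with radius $r$ (i.e. lies on a simply isotropic sphere of cylindrical type of radius $r$) if and only if $\kappa$ is constant and equal to $r^{-1}$.
   Context: Simply isotropic space $\mathbb{I}^3$ is $\mathbb{R}^3$ with the degenerate inner product $\langle\mathbf u,\mathbf v\rangle_z=u_1v_1+u_2v_2$ and $\Vert\mathbf u\Vert_z=\sqrt{\langle\mathbf u,\mathbf u\rangle_z}$. Its rigid motions are the maps $\bar x=a+x\cos\phi-y\sin\phi$, $\bar y=b+x\sin\phi+y\cos\phi$, $\bar z=c_0+c_1x+c_2y+z$, with $a,b,c_i,\phi\in\mathbb{R}$. A curve $\alpha=(x,y,z):I\to\mathbb{I}^3$ on an interval $I$ has unit speed if $\Vert\alpha'\Vert_z=1$. A unit speed curve is admissible if it has no inflection point ($\alpha',\alpha''$ are linearly independent everywhere) and $x'y''-x''y'\neq0$ everywhere. Frenet frame: $\mathbf t=\alpha'$, $\kappa=\Vert\mathbf t'\Vert_z$ (nonzero), $\mathbf n=\mathbf t'/\kappa$, $\mathbf b=(0,0,1)$; it satisfies $\mathbf t'=\kappa\mathbf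 n$, $\mathbf n'=-\kappa\mathbf t+\tau\mathbf b$, $\mathbf b'=0$, which defines the torsion $\tau$. An RM frame is $\{\mathbf t,\mathbf n_1,\mathbf n_2=\mathbf b\}$ with $\mathbf n_1=\mathbf n-\theta\,\mathbf b$, $\theta(s)=\int_{s_0}^s\tau(x)\,\mathrm dx+\tau_0$ for some constant $\tau_0$. It satisfies $\mathbf t'=\kappa_1\mathbf n_1+\kappa_2\mathbf n_2$, $\mathbf n_1'=-\kappa_1\mathbf t$, $\mathbf n_2'=0$ with natural curvatures $\kappa_1=\kappa$, $\kappa_2=\kappa\theta$. A simply isotropic sphere is a connected and irreducible surface of degree 2 of the form $(x^2+y^2)+2c_1x+2c_2y+2c_3z+c_4=0$ with $c_i\in\mathbb{R}$. Up to a rigid motion of $\mathbb{I}^3$ it is either of parabolic type, $z=\frac{1}{2p}(x^2+y^2)$ with $p\neq0$, or of cylindrical type with radius $r>0$, $x^2+y^2=r^2$. Spheres of cylindrical type of radius $r$ are the sets $\{\mathbf x:\langle\mathbf x-P,\mathbf x-P\rangle_z=r^2\}$, $P\in\mathbb{R}^3$. *)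

(* Defs.v *)
From HB Require Import structures.
From mathcomp Require Import all_boot all_order all_algebra.
From mathcomp Require Import all_classical all_reals all_analysis.
Set Implicit Arguments.
Unset Strict Implicit.
Unset Printing Implicit Defensive.
Import Order.TTheory GRing.Theory Num.Theory.
Import numFieldNormedType.Exports.
Local Open Scope classical_set_scope.
Local Open Scope ring_scope.

(* Points and vectors of I^3 are row vectors of length 3; curves are total
   functions R -> 'rV[R]_3 of which only the values on I are ever used. *)

Section IsotropicSpace.
Variable R : realType.
Implicit Types (u v p P : 'rV[R]_3) (S : set 'rV[R]_3).

Definition xc u : R := u 0 0.
Definition yc u : R := u 0 1.
Definition zc u : R := u 0 2.

Definition ez : 'rV[R]_3 := delta_mx 0 2.

Definition isodot u v : R := xc u * xc v + yc u * yc v.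

Definition isonorm u : R := Num.sqrt (isodot u u).

Definition sphere_poly (c1 c2 c3 c4 : R) p : R :=
  (xc p ^+ 2 + yc p ^+ 2) + 2 * c1 * xc p + 2 * c2 * yc p + 2 * c3 * zc p + c4.

(* Irreducibility of a polynomial function of degree 2: a proper factorization
   would have two affine factors. *)
Definition irreducible_deg2 (F : 'rV[R]_3 -> R) : Prop :=
  ~ exists (u v : 'cV[R]_3) (a b : R),
      forall p, F p = ((p *m u) 0 0 + a) * ((p *m v) 0 0 + b).

(* The zero set of F is a (nonempty, regular) surface: some directional
   derivative of F is nonzero at each zero.  This rules out the equations of
   the family whose zero set is empty or a single line. *)
Definition regular_surface (F : 'rV[R]_3 -> R) : Prop :=
  (exists p, F p = 0) /\
  (forall p, F p = 0 -> exists v, 'D_v F p != 0).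

Definition iso_sphere S : Prop :=
  exists c1 c2 c3 c4 : R,
    [/\ S = [set p | sphere_poly c1 c2 c3 c4 p = 0],
        regular_surface (sphere_poly c1 c2 c3 c4),
        connected S
      & irreducible_deg2 (sphere_poly c1 c2 c3 c4)].

Definition cylindrical_sphere (r : R) S : Prop :=
  exists P, S = [set p | isodot (p - P) (p - P) = r ^+ 2].

Definition plane_line (L : set (R * R)) : Prop :=
  exists a b c : R,
    (a, b) != (0, 0) /\ L = [set q | a * q.1 + b * q.2 = c].

End IsotropicSpace.

Section CalculusOnInterval.
Variables (R : realType) (V : normedModType R).
Implicit Types (I : set R) (f : R -> V).

Definition nondegenerate_interval I : Prop :=
  is_interval I /\ exists a b, [/\ I a, I b & a < b].

Definition diff_quotient f (s y : R) : V := (y - s)^-1 *: (f y - f s).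

(* Derivative relative to I, hence one-sided at an endpoint belonging to I. *)
Definition derivable_on I f : Prop :=
  forall s, I s -> cvg (diff_quotient f s @ within I s^').

Definition derive_on I f (s : R) : V :=
  lim (diff_quotient f s @ within I s^').

Definition derive_on_n I (k : nat) f : R -> V := iter k (derive_on I) f.

Definition Cn_on I (k : nat) f : Prop :=
  (forall i, (i < k)%N -> derivable_on I (derive_on_n I i f)) /\
  {within I, continuous (derive_on_n I k f)}.

End CalculusOnInterval.

Definition oriented_integral (R : realType) (f : R -> R) (a b : R) : R :=
  if a <= b then \int[lebesgue_measure]_(x in `[a, b]) f x
  else - \int[lebesgue_measure]_(x in `[b, a]) f x.

Section Curves.
Variable R : realType.
Variables (I : set R) (alpha : R -> 'rV[R]_3).

Definition tangent : R -> 'rV[R]_3 := derive_on I alpha.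

Definition acceleration : R -> 'rV[R]_3 := derive_on I tangent.

Definition regular_curve : Prop := forall s, I s -> tangent s != 0.

Definition unit_speed : Prop := forall s, I s -> isonorm (tangent s) = 1.

Definition admissible : Prop :=
  (forall s, I s -> free [:: tangent s; acceleration s]) /\
  (forall s, I s -> xc (tangent s) * yc (acceleration s)
                    - xc (acceleration s) * yc (tangent s) != 0).

Definition curvature (s : R) : R := isonorm (acceleration s).

Definition normal (s : R) : 'rV[R]_3 := (curvature s)^-1 *: acceleration s.

(* n' = - kappa t + tau b, read along b = (0, 0, 1); the x and y components of
   this equation do not involve tau. *)
Definition torsion (s : R) : R :=
  zc (derive_on I normal s + curvature s *: tangent s).

Definition theta (s0 tau0 s : R) : R := oriented_integral torsion s0 s + tau0.

Definition rm_frame (n1 n2 : R -> 'rV[R]_3) (k1 k2 : R -> R) : Prop :=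
  exists s0 tau0 : R, I s0 /\
    forall s, I s ->
      [/\ n1 s = normal s - theta s0 tau0 s *: ez R,
          n2 s = ez R,
          k1 s = curvature s
        & k2 s = curvature s * theta s0 tau0 s].

End Curves.

(* Main.v *)
Require Import Defs.
From HB Require Import structures.
From mathcomp Require Import all_boot all_order all_algebra.
From mathcomp Require Import all_classical all_reals all_analysis.
From mathcomp Require Import ring lra.
Set Implicit Arguments.
Unset Strict Implicit.
Unset Printing Implicit Defensive.
Import Order.TTheory GRing.Theory Num.Theory.
Import numFieldNormedType.Exports.
Local Open Scope classical_set_scope.
Local Open Scope ring_scope.

(** Throughout, t, n1, b are the vectors of the RM frame, <,> is the degenerate
    product and z the third coordinate; the frame satisfies
    t' = k1 n1 + k2 b and n1' = - k1 t (lemma [rm_frame_equations]).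

    A sphere equation, differentiated once along the curve, becomes
    <X, t> + c3 z(t) = 0, where X = alpha + (c1, c2) in the horizontal plane.
    Differentiating again gives 1 + k1 G + c3 k2 = 0 with
    G = <X, n1> + c3 z(n1).  Since n1 is rotation minimizing,
    G' = <t, n1> - k1 (<X, t> + c3 z(t)) = 0, so G is a constant C and the
    normal development lies on the line C k1 + c3 k2 = -1, which misses the
    origin ([spherical_normal_development]).

    Conversely, a line missing the origin can be normalized to
    A k1 + B k2 = -1.  The computation above prescribes both frame components
    of X: <X, t> = - B z(t) and <X, n1> = A - B z(n1).  The horizontal vector
    with these components, minus alpha, has derivative
    - (1 + A k1 + B k2) t = 0; it is therefore a constant (c1, c2), and the
    corresponding sphere equation is constant along the curve
    ([spherical_of_normal_development]).  Its zero set is a sphere: a graph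
    over the plane if B is nonzero, a round cylinder of radius |A| if B = 0.

    Cylindrical type is the case c3 = 0.  There <X, t> = 0, hence
    C^2 = <X, X> = r^2, and the line C k1 = -1 says that the curvature is 1/r.

    Analytically, the interval may contain its endpoints, so all derivatives are
    limits of difference quotients within I; the only integral involved is the
    torsion angle theta, whose derivative is the torsion because the torsion of
    a C^4 curve is continuous ([oriented_integral_deriv]). *)

(** * Derivatives relative to an interval *)

Section DerivativeWithin.
Variable R : realType.

Definition deriv_within (V : normedModType R) (I : set R) (f : R -> V)
    (s : R) (l : V) : Prop :=
  diff_quotient f s @ within I s^' --> l.

Implicit Types (I : set R) (V : normedModType R).

Lemma within_dnbhs_proper I s : nondegenerate_interval I -> I s ->
  ProperFilter (within I s^').
Proof.
move=> [Iitv [a [b [Ia Ib ab]]]] Is; split; last exact: within_filter.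
rewrite /within/= /dnbhs /within/= => /nbhs_ballP[e /= e0 he].
suff [y [Iy ys ye]] : exists y, [/\ I y, y != s & `|s - y| < e].
  by apply: (he y); rewrite //= -ball_normE.
have [sb|bs] := ltP s b.
- pose y := s + Num.min (e / 2) (b - s).
  have m0 : 0 < Num.min (e / 2) (b - s) by rewrite lt_min divr_gt0//= subr_gt0.
  exists y; split.
  + apply: (Iitv s b) => //; rewrite /y lerDl ltW//= -lerBrDl.
    by rewrite ge_min lexx orbT.
  + by rewrite gt_eqF// /y ltrDl.
  + rewrite /y opprD addrA subrr sub0r normrN gtr0_norm//.
    by rewrite gt_min ltr_pdivrMr// ltr_pMr// ltr1n.
- have as_ : a < s by apply: lt_le_trans bs.
  pose y := s - Num.min (e / 2) (s - a).
  have m0 : 0 < Num.min (e / 2) (s - a) by rewrite lt_min divr_gt0//= subr_gt0.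
  exists y; split.
  + apply: (Iitv a s) => //; rewrite /y gerBl (ltW m0) andbT lerBrDr -lerBrDl.
    by rewrite ge_min lexx orbT.
  + by rewrite lt_eqF// /y gtrBl.
  + rewrite /y opprB addrCA subrr addr0 gtr0_norm//.
    by rewrite gt_min ltr_pdivrMr// ltr_pMr// ltr1n.
Qed.

Lemma deriv_within_unique V I (f : R -> V) s l l' :
  nondegenerate_interval I -> I s ->
  deriv_within I f s l -> deriv_within I f s l' -> l = l'.
Proof.
move=> hI Is hl hl'; have F := within_dnbhs_proper hI Is.
exact: (cvg_unique (@norm_hausdorff _ _) hl hl').
Qed.

Lemma deriv_within_derive_on V I (f : R -> V) s l :
  nondegenerate_interval I -> I s -> deriv_within I f s l ->
  derive_on I f s = l.
Proof.
move=> hI Is hl; have F := within_dnbhs_proper hI Is.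
exact: (cvg_lim (@norm_hausdorff _ _) hl).
Qed.

Lemma derivable_on_deriv_within V I (f : R -> V) s :
  derivable_on I f -> I s -> deriv_within I f s (derive_on I f s).
Proof. by move=> df Is; exact: df. Qed.

Lemma within_filter_dnbhs I s : Filter (within I s^').
Proof. exact: within_filter. Qed.
Local Existing Instance within_filter_dnbhs.

Lemma eq_deriv_within V I (f g : R -> V) s l :
  {in I, f =1 g} -> I s -> deriv_within I g s l -> deriv_within I f s l.
Proof.
move=> fg Is; apply: cvg_trans; apply: near_eq_cvg; near=> y.
rewrite /diff_quotient !fg//; first exact: mem_set.
by apply: mem_set; near: y; exact: withinT.
Unshelve. all: by end_near. Qed.

Lemma deriv_within_cst V I (c : V) s : deriv_within I (fun=> c) s 0.
Proof.
rewrite /deriv_within (_ : diff_quotient _ _ = fun=> 0); first exact: cvg_cst.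
by apply/funext => y; rewrite /diff_quotient subrr scaler0.
Qed.

Lemma deriv_withinD V I (f g : R -> V) s a b :
  deriv_within I f s a -> deriv_within I g s b ->
  deriv_within I (fun y => f y + g y) s (a + b).
Proof.
move=> fa gb; rewrite /deriv_within.
have -> : diff_quotient (fun y => f y + g y) s
        = fun y => diff_quotient f s y + diff_quotient g s y.
  by apply/funext => y; rewrite /diff_quotient -scalerDr opprD addrACA.
exact: cvgD.
Qed.

Lemma deriv_within_cvg_dnbhs V I (f : R -> V) s a :
  deriv_within I f s a -> f @ within I s^' --> f s.
Proof.
move=> fa.
have sub0 : (fun y : R => y - s) @ within I s^' --> (0 : R).
  rewrite -(subrr s); apply: cvgB; last exact: cvg_cst.
  by move=> A /nbhs_dnbhs; exact: cvg_within.
have -> : f s = f s + (0 : R) *: a by rewrite scale0r addr0.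
apply: (cvg_trans _ (cvgD (cvg_cst (f s)) (cvgZ sub0 fa))).
apply: near_eq_cvg; near=> y.
rewrite /diff_quotient fctE /= scalerA divff ?scale1r.
  by rewrite addrC subrK.
rewrite subr_eq0; near: y.
by apply: filterS (nbhs_dnbhs_neq s) => y /= + _; exact.
Unshelve. all: by end_near. Qed.

Lemma deriv_within_continuous V I (f : R -> V) :
  (forall s, I s -> exists l, deriv_within I f s l) -> {within I, continuous f}.
Proof.
move=> df; apply/subspace_continuousP => s /df[l].
move=> /deriv_within_cvg_dnbhs fs A fA.
have fsA : \forall y \near s, y != s -> I y -> A (f y) := fs _ fA.
suff : \forall y \near s, I y -> A (f y) by [].
apply: filterS fsA => y H Iy; have [->|ys] := eqVneq y s; last exact: H.
exact: nbhs_singleton fA.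
Qed.

Lemma deriv_withinZ V I (k : R -> R) (f : R -> V) s a b :
  deriv_within I k s a -> deriv_within I f s b ->
  deriv_within I (fun y => k y *: f y) s (a *: f s + k s *: b).
Proof.
move=> ka fb; have fs := deriv_within_cvg_dnbhs fb; rewrite /deriv_within.
have -> : diff_quotient (fun y => k y *: f y) s
        = fun y => diff_quotient k s y *: f y + k s *: diff_quotient f s y.
  apply/funext => y; rewrite /diff_quotient scalerA [k s * _]mulrC -!scalerA.
  rewrite -scalerDr; congr (_ *: _).
  by rewrite scalerBl scalerBr addrA subrK.
by apply: cvgD; apply: cvgZ => //; exact: cvg_cst.
Qed.

Lemma deriv_withinM I (f g : R -> R) s a b :
  deriv_within I f s a -> deriv_within I g s b ->
  deriv_within I (fun y => f y * g y) s (a * g s + f s * b).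
Proof. exact: deriv_withinZ. Qed.

(** The ordinary derivative is the case where I is a neighbourhood of the point;
    differentiation rules for [is_derive] thus carry over. *)
Lemma is_deriveP V (f : R -> V) (s : R) l :
  @is_derive R R V s 1 f l <-> diff_quotient f s @ s^' --> l.
Proof.
have E : diff_quotient f s @ s^' =
    (fun h => h^-1 *: ((f \o shift s) (h *: 1) - f s)) @ 0^'.
  apply/funext => A; rewrite /= /dnbhs /within /= !near_simpl.
  rewrite [LHS](near_shift 0 s) subr0; apply: eq_near => h /=.
  rewrite /diff_quotient addrK (_ : (h + s != s) = (h != 0)); last first.
    by rewrite -subr_eq0 addrK.
  by rewrite /= [h *: 1]mulr1.
rewrite E; split=> [[/cvg_ex[/= l' hl'] <-]|hl].
  by rewrite /derive (cvg_lim (@norm_hausdorff _ _) hl').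
split; first by apply/cvg_ex; exists l.
exact: (cvg_lim (@norm_hausdorff _ _) hl).
Qed.

Lemma is_derive_deriv_within V I (f : R -> V) s l :
  @is_derive R R V s 1 f l -> deriv_within I f s l.
Proof. by move=> /is_deriveP; exact: cvg_within_filter. Qed.

Lemma deriv_within_is_derive V I (f : R -> V) s l :
  nbhs s I -> deriv_within I f s l -> @is_derive R R V s 1 f l.
Proof.
move=> sI fl; apply/is_deriveP => A lA.
have H : \forall y \near s, y != s -> I y -> A (diff_quotient f s y) := fl _ lA.
suff : \forall y \near s, y != s -> A (diff_quotient f s y) by [].
by apply: filterS2 sI H => y Iy H ys; exact: H.
Qed.

(** The slope of g at f s is extended by b at f s itself: the factorization of the
    difference quotient then survives at the points y where f y = f s. *)
Lemma deriv_within_comp I (g f : R -> R) s a b :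
  is_derive (f s) 1 g b -> deriv_within I f s a ->
  deriv_within I (g \o f) s (b * a).
Proof.
move=> /is_deriveP gb fa; have fs := deriv_within_cvg_dnbhs fa.
pose slope u := if u == f s then b else diff_quotient g (f s) u.
have slopeb : slope u @[u --> f s] --> b.
  move=> A bA.
  have H : \forall u \near f s, u != f s -> A (diff_quotient g (f s) u) :=
    gb _ bA.
  suff : \forall u \near f s, A (slope u) by [].
  apply: filterS H => u H; rewrite /slope; case: eqP => [_|/eqP /H//].
  exact: nbhs_singleton bA.
rewrite /deriv_within.
have -> : diff_quotient (g \o f) s
        = (fun y => slope (f y) * diff_quotient f s y).
  apply/funext => y; rewrite /slope /diff_quotient /=.
  case: eqP => [->|/eqP fyfs]; first by rewrite !subrr !scaler0 mulr0.
  rewrite /GRing.scale/= mulrCA; congr (_ * _).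
  by rewrite mulrAC mulVf ?mul1r// subr_eq0.
by apply: cvgM => //; exact: cvg_comp fs slopeb.
Qed.

Lemma deriv_within_eq V I (f : R -> V) s l l' :
  deriv_within I f s l -> l = l' -> deriv_within I f s l'.
Proof. by move=> + <-. Qed.

Lemma deriv_withinV I (f : R -> R) s a :
  f s != 0 -> deriv_within I f s a ->
  deriv_within I (fun y => (f y)^-1) s (- (f s) ^- 2 * a).
Proof.
move=> fs0 fa; apply: (deriv_within_comp (g := GRing.inv)) fa.
have /= := is_deriveV fs0 (is_derive_id (f s) 1).
by rewrite [_ *: 1]mulr1.
Qed.

Lemma deriv_within_sqrt I (f : R -> R) s a :
  0 < f s -> deriv_within I f s a ->
  deriv_within I (fun y => Num.sqrt (f y)) s ((2 * Num.sqrt (f s))^-1 * a).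
Proof.
move=> fs0; apply: (deriv_within_comp (g := Num.sqrt)).
exact: is_derive1_sqrt.
Qed.

(** Between two points of I the mean value theorem only needs the derivative in
    the interior and continuity up to the ends. *)
Lemma deriv_within0_cst I (f : R -> R) :
  is_interval I -> (forall s, I s -> deriv_within I f s 0) ->
  forall s s', I s -> I s' -> f s = f s'.
Proof.
move=> Iitv f0 s s'; wlog ss' : s s' / s <= s' => [H Is Is'|Is Is'].
  by have [/H|/ltW/H h] := leP s s'; [exact|apply/esym/h].
have sub : `[s, s'] `<=` I.
  by move=> x; rewrite /= in_itv/= => sxs'; exact: (Iitv s s').
have df x : x \in `]s, s'[%R -> @is_derive R R R x 1 f 0.
  move=> xss'; apply: (@deriv_within_is_derive _ I).
    apply: filterS (near_in_itvoo xss') => y yss'.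
    by apply: sub; exact: subset_itv_oo_cc.
  by apply: f0; apply: sub; exact: subset_itv_oo_cc.
have cf : {within `[s, s'], continuous f}.
  apply: continuous_subspaceW sub _; apply: deriv_within_continuous => x Ix.
  by exists 0; exact: f0.
have [c _] := MVT_segment ss' df cf.
by rewrite mul0r => /eqP; rewrite subr_eq0 => /eqP.
Qed.

(** A neighbourhood of s in I is contained in a segment of I: its lower end is
    either strictly below s or the least point of I, and likewise above. *)
Lemma interval_segment_nbhs I s0 s : is_interval I -> I s0 -> I s ->
  exists lo hi, [/\ I lo, I hi, lo <= s0 <= hi, lo <= s <= hi
    & \forall y \near s, I y -> lo <= y <= hi].
Proof.
move=> Iitv Is0 Is.
have [lo [Ilo los0 los nlo]] : exists lo, [/\ I lo, lo <= s0, lo <= s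
    & \forall y \near s, I y -> lo <= y].
  have [[a [Ia aI]]|noa] := pselect (exists a, I a /\ a < Num.min s0 s).
    move: aI; rewrite lt_min => /andP[as0 as_].
    exists a; split => //; [exact: ltW..|].
    by have := lt_nbhsr as_; apply: filterS => y /ltW.
  exists (Num.min s0 s); split; rewrite ?ge_min ?lexx ?orbT//.
    by rewrite /Num.min; case: ifP.
  apply: (@filterE _ (nbhs s)) => y Iy; rewrite leNgt; apply/negP => ym.
  by apply: noa; exists y.
have [hi [Ihi s0hi shi nhi]] : exists hi, [/\ I hi, s0 <= hi, s <= hi
    & \forall y \near s, I y -> y <= hi].
  have [[a [Ia aI]]|noa] := pselect (exists a, I a /\ Num.max s0 s < a).
    move: aI; rewrite gt_max => /andP[as0 as_].
    exists a; split => //; [exact: ltW..|].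
    by have := lt_nbhsl as_; apply: filterS => y /ltW.
  exists (Num.max s0 s); split; rewrite ?le_max ?lexx ?orbT//.
    by rewrite /Num.max; case: ifP.
  apply: (@filterE _ (nbhs s)) => y Iy; rewrite leNgt; apply/negP => ym.
  by apply: noa; exists y.
exists lo, hi; split; rewrite ?los0 ?los//.
by apply: filterS2 nlo nhi => y h1 h2 Iy; rewrite h1 ?h2.
Qed.

(** Extending f from a segment of I to the line by its values at the ends makes it
    continuous everywhere.  This reduces the one-sided statements at the endpoints
    of I, as well as both orientations of the integral, to the fundamental theorem
    of calculus at an interior point. *)
Lemma oriented_integral_deriv I (f : R -> R) s0 s :
  is_interval I -> {within I, continuous f} -> I s0 -> I s ->
  deriv_within I (oriented_integral f s0) s (f s).
Proof.
move=> Iitv cf Is0 Is.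
have [lo [hi [Ilo Ihi s0lh slh nI]]] := interval_segment_nbhs Iitv Is0 Is.
have lohi : lo <= hi by case/andP: slh; exact: le_trans.
pose clamp x := Num.max lo (Num.min hi x).
have Iclamp x : I (clamp x).
  apply: (Iitv lo hi) => //; rewrite /clamp le_max lexx/=.
  by rewrite ge_max lohi ge_min lexx.
have clampE x : lo <= x <= hi -> clamp x = x.
  by move=> /andP[lox xhi]; rewrite /clamp min_r// max_r.
pose g := f \o clamp.
have cg : continuous g.
  move=> x; have cclamp : clamp @ x --> clamp x.
    apply: (@continuous_max _ _ (fun=> lo) (fun y => Num.min hi y)).
      exact: cst_continuous.
    apply: (@continuous_min _ _ (fun=> hi) (fun y => y)).
      exact: cst_continuous.
    exact: cvg_id.
  have /subspace_continuousP/(_ _ (Iclamp x)) fc := cf.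
  apply: cvg_comp fc => A hA.
  have hA' : \forall y \near clamp x, I y -> A y by exact: hA.
  have hAc : \forall y \near x, I (clamp y) -> A (clamp y) := cclamp _ hA'.
  suff : \forall y \near x, A (clamp y) by [].
  by apply: filterS hAc => y /(_ (Iclamp y)).
have ig a b : lebesgue_measure.-integrable `[a, b] (EFin \o g).
  apply: continuous_compact_integrable; first exact: segment_compact.
  exact: continuous_subspaceT.
(* The lower limit is lo - 1 so that lo, too, is interior to the domain of G. *)
pose G x := \int[lebesgue_measure]_(t in `[lo - 1, x]) g t.
have dG x : lo <= x -> is_derive x 1 G (g x).
  move=> lox; have lo1x : lo - 1 < x by rewrite ltrBlDr ltr_pwDr.
  have xx1 : x < x + 1 by rewrite ltrDl.
  have [dGx G'x] := continuous_FTC1_closed xx1 (ig _ _) lo1x (cg x).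
  by split => //; rewrite -derive1E.
have int_fG a b : lo <= a -> a <= b -> b <= hi ->
    \int[lebesgue_measure]_(t in `[a, b]) f t = G b - G a.
  move=> loa ab bhi.
  have lo1a : lo - 1 <= a by rewrite lerBlDr ler_wpDr.
  rewrite /G Rintegral_itvB//= Rintegral_itv_obnd_cbnd//; last first.
    by apply: integrableS (ig a b) => //; exact: subset_itv_oc_cc.
  apply: eq_Rintegral => x; rewrite inE/= in_itv/= => /andP[ax xb].
  by rewrite /g/= clampE// (le_trans loa ax) (le_trans xb).
have oG y : lo <= y <= hi -> oriented_integral f s0 y = G y - G s0.
  case/andP: s0lh => los0 s0hi /andP[loy yhi]; rewrite /oriented_integral.
  case: leP => [s0y|/ltW ys0]; first exact: int_fG.
  by rewrite int_fG// opprB.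
have <- : g s = f s by rewrite /g/= clampE.
have : deriv_within I G s (g s).
  by apply: is_derive_deriv_within; apply: dG; case/andP: slh.
apply: cvg_trans; apply: near_eq_cvg.
have H : \forall y \near s, y != s -> I y ->
    diff_quotient G s y = diff_quotient (oriented_integral f s0) s y.
  apply: filterS nI => y ylh _ Iy.
  by rewrite /diff_quotient !oG ?ylh// opprB addrA subrK.
exact: H.
Qed.

Lemma deriv_within_coord n I (f : R -> 'rV[R]_n.+1) s l (i : 'I_n.+1) :
  deriv_within I f s l -> deriv_within I (fun y => f y 0 i) s (l 0 i).
Proof.
rewrite /deriv_within => fl.
have -> : diff_quotient (fun y => f y 0 i) s
        = (fun M : 'rV[R]_n.+1 => M 0 i) \o diff_quotient f s.
  by apply/funext => y; rewrite /diff_quotient /= !mxE.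
exact: (cvg_comp _ _ fl (@coord_continuous R 1 n.+1 0 i l)).
Qed.

End DerivativeWithin.

(** * Simply isotropic spheres *)

Section Spheres.
Variable R : realType.

(** The quadratic part x^2 + y^2 would be the product of the linear parts of the
    factors; it is anisotropic in (x, y), hence not such a product over R. *)
Lemma sphere_poly_irreducible (c1 c2 c3 c4 : R) :
  irreducible_deg2 (sphere_poly c1 c2 c3 c4).
Proof.
move=> [u [v [a [b H]]]].
(* The linear terms cancel in F p + F (- p), and F 0 removes the constant. *)
have quad p : xc p ^+ 2 + yc p ^+ 2 = (p *m u) 0 0 * (p *m v) 0 0.
  have := H p; have := H (- p); have := H 0.
  rewrite /sphere_poly /xc /yc /zc !mulNmx !mul0mx !mxE.
  lra.
pose e (x y : R) : 'rV[R]_3 := x *: delta_mx 0 0 + y *: delta_mx 0 1.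
have eu x y (w : 'cV[R]_3) : (e x y *m w) 0 0 = x * w 0 0 + y * w 1 0.
  by rewrite /e mulmxDl -!scalemxAl -!rowE !mxE.
have := quad (e 1 0); have := quad (e 0 1); have := quad (e 1 1).
rewrite !eu /xc /yc /e !mxE/=.
set p := u 0 0; set q := u 1 0; set r := v 0 0; set t := v 1 0.
rewrite !(mul1r, mul0r, mulr1, mulr0, addr0, add0r, expr1n).
nra.
Qed.

Lemma fst_continuous : continuous (fst : R * R -> R).
Proof. by move=> q; exact: cvg_fst. Qed.

Lemma snd_continuous : continuous (snd : R * R -> R).
Proof. by move=> q; exact: cvg_snd. Qed.

(** The plane is a union of lines through the origin.  Both types of spheres are
    continuous images of it, hence connected. *)
Lemma connected_plane : connected [set: R * R].
Proof.
have -> : [set: R * R] =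
    \bigcup_(p : R * R) ((fun t => (t * p.1, t * p.2)) @` [set: R]).
  apply/seteqP; split => // p _; exists p => //; exists 1 => //.
  by rewrite !mul1r; case: p.
apply: bigcup_connected.
  by exists (0, 0) => p _; exists 0 => //; rewrite !mul0r.
move=> p _; apply: connected_continuous_connected.
  by apply/connected_intervalP.
apply: continuous_subspaceT => t.
apply: (@cvg_pair _ _ _ _ (nbhs (t * p.1)) (nbhs (t * p.2)));
  by apply: cvgMr_tmp; exact: cvg_id.
Qed.

Definition point3 (x y z : R) : 'rV[R]_3 :=
  x *: delta_mx 0 0 + y *: delta_mx 0 1 + z *: delta_mx 0 2.

Lemma xc_point3 x y z : xc (point3 x y z) = x.
Proof. by rewrite /xc !mxE/= !(mulr1, mulr0, addr0). Qed.

Lemma yc_point3 x y z : yc (point3 x y z) = y.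
Proof. by rewrite /yc !mxE/= !(mulr1, mulr0, addr0, add0r). Qed.

Lemma zc_point3 x y z : zc (point3 x y z) = z.
Proof. by rewrite /zc !mxE/= !(mulr1, mulr0, addr0, add0r). Qed.

Lemma point3_eta p : p = point3 (xc p) (yc p) (zc p).
Proof.
apply/rowP => -[[|[|[|//]]] i]; rewrite !mxE/= !(mulr1, mulr0, addr0, add0r);
  by congr (p _ _); exact/val_inj.
Qed.

Lemma continuous_point3 (T : topologicalType) (x y z : T -> R) :
  continuous x -> continuous y -> continuous z ->
  continuous (fun t => point3 (x t) (y t) (z t)).
Proof.
move=> cx cy cz t; apply: cvgD; first apply: cvgD.
- by apply: cvgZr_tmp; exact: cx.
- by apply: cvgZr_tmp; exact: cy.
- by apply: cvgZr_tmp; exact: cz.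
Qed.

Lemma derive_sphere_poly (c1 c2 c3 c4 : R) (p v : 'rV[R]_3) :
  'D_v (sphere_poly c1 c2 c3 c4) p =
  2 * ((xc p + c1) * xc v + (yc p + c2) * yc v + c3 * zc v).
Proof.
set l := RHS; apply: (cvg_lim (@norm_hausdorff _ _)).
pose q := xc v ^+ 2 + yc v ^+ 2.
have h0 : (l + h * q) @[h --> (0 : R)^'] --> l.
  rewrite -[X in _ --> X]addr0 -[X in _ --> _ + X](mul0r q).
  apply: cvgD; first exact: cvg_cst.
  by apply: cvgMr_tmp; exact: nbhs_dnbhs.
apply: cvg_trans h0; apply: near_eq_cvg.
have := nbhs_dnbhs_neq (0 : R).
apply: filterS => h hn0.
rewrite /l /q /sphere_poly /= /xc /yc /zc !mxE /GRing.scale/=.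
field.
exact: hn0.
Qed.

Lemma graph_iso_sphere (c1 c2 c3 c4 : R) : c3 != 0 ->
  iso_sphere [set p | sphere_poly c1 c2 c3 c4 p = 0].
Proof.
move=> c3n0; exists c1, c2, c3, c4.
pose height x y :=
  - (x ^+ 2 + y ^+ 2 + 2 * c1 * x + 2 * c2 * y + c4) / (2 * c3).
have graph x y : sphere_poly c1 c2 c3 c4 (point3 x y (height x y)) = 0.
  by rewrite /sphere_poly xc_point3 yc_point3 zc_point3 /height; field.
split => //; last exact: sphere_poly_irreducible.
- split; first by exists (point3 0 0 (height 0 0)).
  move=> p _; exists (point3 0 0 1).
  rewrite derive_sphere_poly xc_point3 yc_point3 zc_point3.
  by rewrite !mulr0 !add0r mulr1 mulf_neq0// pnatr_eq0.
- have -> : [set p | sphere_poly c1 c2 c3 c4 p = 0] =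
     (fun q => point3 q.1 q.2 (height q.1 q.2)) @` [set: R * R].
    apply/seteqP; split => [p /= Hp|p [q _ <-]]; last exact: graph.
    exists (xc p, yc p) => //=; rewrite [RHS]point3_eta; congr point3.
    apply: (mulfI c3n0); move: Hp; rewrite /height /sphere_poly => Hp.
    apply: (@mulfI _ 2) => //; rewrite mulrA mulrC mulfVK; last first.
      by rewrite mulf_neq0// pnatr_eq0.
    lra.
  apply: connected_continuous_connected; first exact: connected_plane.
  apply: continuous_subspaceT; apply: continuous_point3.
  + exact: fst_continuous.
  + exact: snd_continuous.
  + move=> q; apply: cvgMr_tmp; apply: cvgN.
    have cx := @fst_continuous q; have cy := @snd_continuous q.
    apply: cvgD; last exact: cvg_cst.
    apply: cvgD; last by apply: cvgMl_tmp.
    apply: cvgD; last by apply: cvgMl_tmp.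
    by apply: cvgD; rewrite expr2; under [X in X @ _]funext do rewrite expr2;
      apply: cvgM.
Qed.

Lemma polar_angle (r a b : R) : 0 < r -> a ^+ 2 + b ^+ 2 = r ^+ 2 ->
  exists t, r * cos t = a /\ r * sin t = b.
Proof.
move=> r0 abr; have rn0 : r != 0 by rewrite gt_eqF.
have u1 : (a / r) ^+ 2 + (b / r) ^+ 2 = 1.
  by rewrite !expr_div_n -mulrDl abr divff// expf_neq0.
have a1 : -1 <= a / r <= 1 by apply/andP; split; nra.
have sa : Num.sqrt (1 - (a / r) ^+ 2) = `|b / r|.
  by rewrite -u1 addrAC subrr add0r sqrtr_sqr.
have bE : r * (b / r) = b by rewrite mulrC divfK.
have aE : r * (a / r) = a by rewrite mulrC divfK.
have [b0|b0] := leP 0 (b / r).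
  exists (acos (a / r)); rewrite acosK// sin_acos// sa ger0_norm//.
exists (- acos (a / r)); rewrite cosN sinN acosK// sin_acos// sa ltr0_norm//.
by rewrite opprK.
Qed.

Lemma cylinder_iso_sphere (c1 c2 c4 r : R) :
  0 < r -> c1 ^+ 2 + c2 ^+ 2 - c4 = r ^+ 2 ->
  iso_sphere [set p : 'rV[R]_3 | sphere_poly c1 c2 0 c4 p = 0].
Proof.
move=> r0 rE; exists c1, c2, 0, c4.
have polyE p : sphere_poly c1 c2 0 c4 p =
    (xc p + c1) ^+ 2 + (yc p + c2) ^+ 2 - r ^+ 2.
  by rewrite -rE /sphere_poly; ring.
split => //; last exact: sphere_poly_irreducible.
- split.
    exists (point3 (r - c1) (- c2) 0).
    by rewrite polyE xc_point3 yc_point3; ring.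
  move=> p; rewrite polyE => Hp.
  exists (point3 (xc p + c1) (yc p + c2) 0).
  rewrite derive_sphere_poly xc_point3 yc_point3 mul0r addr0 -!expr2.
  by rewrite (subr0_eq Hp) mulf_neq0 ?pnatr_eq0// sqrf_eq0 gt_eqF.
- have -> : [set p | sphere_poly c1 c2 0 c4 p = 0] =
     (fun q => point3 (r * cos q.1 - c1) (r * sin q.1 - c2) q.2) @` [set: R * R].
    apply/seteqP; split => [p /=|p [q _ <-]]; rewrite /= polyE; last first.
      rewrite xc_point3 yc_point3 !subrK !exprMn -mulrDr cos2Dsin2 mulr1 subrr.
      by [].
    move=> /subr0_eq Hp.
    have [t [ct st]] := polar_angle r0 Hp.
    exists (t, zc p) => //=; rewrite [RHS]point3_eta ct st !addrK.
    by [].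
  apply: connected_continuous_connected; first exact: connected_plane.
  apply: continuous_subspaceT; apply: continuous_point3.
  + move=> q; apply: cvgB; last exact: cvg_cst.
    by apply: cvgMl_tmp; apply: (continuous_comp (f := fst) (g := cos));
      [exact: fst_continuous|exact: continuous_cos].
  + move=> q; apply: cvgB; last exact: cvg_cst.
    by apply: cvgMl_tmp; apply: (continuous_comp (f := fst) (g := sin));
      [exact: fst_continuous|exact: continuous_sin].
  + exact: snd_continuous.
Qed.

End Spheres.

(** * Frames and spherical curves *)

Section Frames.
Variable R : realType.

(** An orthonormal pair in the plane is determined by its first vector up to the
    sign d; this is what makes it a basis. *)
Lemma orthonormal_plane (tx ty mx my : R) :
  tx * tx + ty * ty = 1 -> mx * mx + my * my = 1 -> tx * mx + ty * my = 0 ->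
  exists d, [/\ d ^+ 2 = 1, mx = d * - ty & my = d * tx].
Proof.
move=> tt mm tm; exists (tx * my - ty * mx); split.
- transitivity ((tx * tx + ty * ty) * (mx * mx + my * my) -
                (tx * mx + ty * my) ^+ 2); first ring.
  by rewrite tt mm tm; ring.
- transitivity (mx * (tx * tx + ty * ty) - tx * (tx * mx + ty * my)).
    by rewrite tt tm; ring.
  by ring.
- transitivity (my * (tx * tx + ty * ty) - ty * (tx * mx + ty * my)).
    by rewrite tt tm; ring.
  by ring.
Qed.

Definition rm_equations (I : set R) (alpha t m : R -> 'rV[R]_3)
    (k1 k2 : R -> R) : Prop :=
  forall s, I s ->
    [/\ deriv_within I alpha s (t s),
        deriv_within I t s (k1 s *: m s + k2 s *: ez R)
      & deriv_within I m s (- k1 s *: t s)].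

Definition isotropic_orthonormal (u v : 'rV[R]_3) : Prop :=
  [/\ isodot u u = 1, isodot v v = 1 & isodot u v = 0].

Lemma xc_ez : xc (ez R) = 0. Proof. by rewrite /xc mxE. Qed.
Lemma yc_ez : yc (ez R) = 0. Proof. by rewrite /yc mxE. Qed.
Lemma zc_ez : zc (ez R) = 1. Proof. by rewrite /zc mxE. Qed.

Lemma xcD u v : xc (u + v) = xc u + xc v :> R. Proof. by rewrite /xc mxE. Qed.
Lemma ycD u v : yc (u + v) = yc u + yc v :> R. Proof. by rewrite /yc mxE. Qed.
Lemma zcD u v : zc (u + v) = zc u + zc v :> R. Proof. by rewrite /zc mxE. Qed.
Lemma xcZ k u : xc (k *: u) = k * xc u :> R. Proof. by rewrite /xc mxE. Qed.
Lemma ycZ k u : yc (k *: u) = k * yc u :> R. Proof. by rewrite /yc mxE. Qed.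
Lemma zcZ k u : zc (k *: u) = k * zc u :> R. Proof. by rewrite /zc mxE. Qed.

Definition coordE := (xcD, ycD, zcD, xcZ, ycZ, zcZ, xc_ez, yc_ez, zc_ez).

Lemma deriv_within_xyz I (f : R -> 'rV[R]_3) s l : deriv_within I f s l ->
  [/\ deriv_within I (fun y => xc (f y)) s (xc l),
      deriv_within I (fun y => yc (f y)) s (yc l)
    & deriv_within I (fun y => zc (f y)) s (zc l)].
Proof. by move=> fl; split; exact: deriv_within_coord. Qed.

Lemma deriv_within_sqr I (f : R -> R) s a : deriv_within I f s a ->
  deriv_within I (fun y => f y ^+ 2) s (2 * f s * a).
Proof.
move=> fa; apply: deriv_within_eq; first exact: (deriv_withinM fa fa).
by ring.
Qed.

Lemma deriv_within_const_eq0 I (f : R -> R) s l c :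
  nondegenerate_interval I -> I s -> (forall y, I y -> f y = c) ->
  deriv_within I f s l -> l = 0.
Proof.
move=> hI Is fc fl; apply: (deriv_within_unique hI Is fl).
apply: (@eq_deriv_within _ _ _ _ (fun=> c)) => //.
- by move=> y; rewrite inE => /fc.
- exact: deriv_within_cst.
Qed.

End Frames.

(** The dispatch is syntactic: unification up to conversion would try to identify
    different coordinate functions by unfolding them. *)
Ltac deriv_within_rules :=
  lazymatch goal with
  | H : deriv_within ?I ?f ?s _ |- deriv_within ?I ?f ?s _ => exact: H
  | |- deriv_within _ (fun y => @?f y + @?g y) _ _ =>
      apply: (@deriv_withinD _ _ _ f g); deriv_within_rules
  | |- deriv_within _ (fun y => @?f y * @?g y) _ _ =>
      apply: (@deriv_withinM _ _ f g); deriv_within_rules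
  | |- deriv_within _ (fun y => @?f y ^+ 2) _ _ =>
      apply: (@deriv_within_sqr _ _ f); deriv_within_rules
  | |- _ => apply: deriv_within_cst
  end.

Section SphericalCurves.
Variable R : realType.
Variables (I : set R) (alpha t m : R -> 'rV[R]_3) (k1 k2 : R -> R).
Hypothesis hI : nondegenerate_interval I.
Hypothesis rmE : rm_equations I alpha t m k1 k2.
Hypothesis tmE : forall s, I s -> isotropic_orthonormal (t s) (m s).

(** The last clause is Parseval's identity for X, whose t-component vanishes when
    c3 = 0; it identifies C up to sign with the radius of the cylinder. *)
Lemma spherical_normal_development c1 c2 c3 c4 :
  (forall s, I s -> sphere_poly c1 c2 c3 c4 (alpha s) = 0) ->
  exists C, forall s, I s -> C * k1 s + c3 * k2 s = -1 /\
    (c3 = 0 -> (xc (alpha s) + c1) ^+ 2 + (yc (alpha s) + c2) ^+ 2 = C ^+ 2).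
Proof.
move=> sph.
(* F is half the derivative of the sphere equation, and G pairs half its
   gradient with m. *)
pose F y := (xc (alpha y) + c1) * xc (t y) + (yc (alpha y) + c2) * yc (t y)
            + c3 * zc (t y).
pose G y := (xc (alpha y) + c1) * xc (m y) + (yc (alpha y) + c2) * yc (m y)
            + c3 * zc (m y).
have F0 s : I s -> F s = 0.
  move=> Is; have [/deriv_within_xyz[ax ay az] _ _] := rmE Is.
  have : 2 * F s = 0.
    apply: (deriv_within_const_eq0 hI Is sph); rewrite /sphere_poly.
    apply: deriv_within_eq; first by deriv_within_rules.
    by rewrite /F; ring.
  by move/eqP; rewrite mulf_eq0 pnatr_eq0/= => /eqP.
have dF s : I s -> 1 + G s * k1 s + c3 * k2 s = 0.
  move=> Is; have [/deriv_within_xyz[ax ay az] /deriv_within_xyz[tx ty tz] _] :=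
    rmE Is.
  have [tt _ _] := tmE Is.
  apply: (deriv_within_const_eq0 hI Is F0); rewrite /F.
  apply: deriv_within_eq; first by deriv_within_rules.
  transitivity (isodot (t s) (t s) + G s * k1 s + c3 * k2 s).
    by rewrite !coordE /isodot /G; ring.
  by rewrite tt.
have dG s : I s -> deriv_within I G s 0.
  move=> Is; have [/deriv_within_xyz[ax ay az] _ /deriv_within_xyz[mx my mz]] :=
    rmE Is.
  have [_ _ tm] := tmE Is.
  apply: deriv_within_eq; first by rewrite /G; deriv_within_rules.
  transitivity (isodot (t s) (m s) - k1 s * F s).
    by rewrite !coordE /isodot /F; ring.
  by rewrite tm F0//; ring.
have [Iitv [s0 [_ [Is0 _ _]]]] := hI.
exists (G s0) => s Is; have GE := deriv_within0_cst Iitv dG Is0 Is.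
split; first by rewrite GE; have := dF s Is; lra.
move=> c30; have := F0 s Is; rewrite GE /F /G c30 !mul0r !addr0.
have [tt mm tm] := tmE Is.
have [d [d1 -> ->]] := orthonormal_plane tt mm tm.
set X := xc (alpha s) + c1; set Y := yc (alpha s) + c2 => XY.
transitivity ((X * xc (t s) + Y * yc (t s)) ^+ 2 +
  d ^+ 2 * (Y * xc (t s) - X * yc (t s)) ^+ 2); last first.
  by rewrite XY; ring.
rewrite d1; transitivity ((X ^+ 2 + Y ^+ 2) * isodot (t s) (t s)).
  by rewrite tt mulr1.
by rewrite /isodot; ring.
Qed.

(** The last clause says that for B = 0 the sphere found is the cylinder of radius
    |A|. *)
Lemma spherical_of_normal_development A B :
  (forall s, I s -> A * k1 s + B * k2 s = -1) ->
  exists c1 c2 c4, (forall s, I s -> sphere_poly c1 c2 B c4 (alpha s) = 0) /\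
    (B = 0 -> c1 ^+ 2 + c2 ^+ 2 - c4 = A ^+ 2).
Proof.
move=> line; have [Iitv [s0 [_ [Is0 _ _]]]] := hI.
(* Minus alpha, plus the horizontal vector with t-component - B z(t) and
   m-component A - B z(m). *)
pose cx y := - 1 * xc (alpha y) + (- B) * (zc (t y) * xc (t y))
             + (A + (- B) * zc (m y)) * xc (m y).
pose cy y := - 1 * yc (alpha y) + (- B) * (zc (t y) * yc (t y))
             + (A + (- B) * zc (m y)) * yc (m y).
have dc s : I s -> deriv_within I cx s 0 /\ deriv_within I cy s 0.
  move=> Is; have [/deriv_within_xyz[ax ay az] /deriv_within_xyz[tx ty tz]
    /deriv_within_xyz[mx my mz]] := rmE Is.
  split; (apply: deriv_within_eq; first by rewrite /cx /cy; deriv_within_rules).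
  - transitivity (- (1 + (A * k1 s + B * k2 s)) * xc (t s)).
      by rewrite !coordE; ring.
    by rewrite line//; ring.
  - transitivity (- (1 + (A * k1 s + B * k2 s)) * yc (t s)).
      by rewrite !coordE; ring.
    by rewrite line//; ring.
pose c1 := cx s0; pose c2 := cy s0.
have XE s : I s -> xc (alpha s) + c1 =
    - B * zc (t s) * xc (t s) + (A - B * zc (m s)) * xc (m s).
  move=> Is; have dci y Iy := (dc y Iy).1.
  rewrite /c1 (deriv_within0_cst Iitv dci Is0 Is).
  by rewrite /cx; ring.
have YE s : I s -> yc (alpha s) + c2 =
    - B * zc (t s) * yc (t s) + (A - B * zc (m s)) * yc (m s).
  move=> Is; have dci y Iy := (dc y Iy).2.
  rewrite /c2 (deriv_within0_cst Iitv dci Is0 Is).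
  by rewrite /cy; ring.
pose H y := sphere_poly c1 c2 B 0 (alpha y).
have dH s : I s -> deriv_within I H s 0.
  move=> Is; have [/deriv_within_xyz[ax ay az] _ _] := rmE Is.
  have [tt _ tm] := tmE Is; rewrite /H /sphere_poly.
  apply: deriv_within_eq; first by deriv_within_rules.
  transitivity (2 * ((xc (alpha s) + c1) * xc (t s) +
    (yc (alpha s) + c2) * yc (t s) + B * zc (t s))); first by ring.
  rewrite XE// YE//.
  transitivity (2 * (- B * zc (t s) * isodot (t s) (t s) +
    (A - B * zc (m s)) * isodot (t s) (m s) + B * zc (t s))).
    by rewrite /isodot; ring.
  by rewrite tt tm; ring.
have polyE c p : sphere_poly c1 c2 B c p = sphere_poly c1 c2 B 0 p + c.
  by rewrite /sphere_poly addr0.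
exists c1, c2, (- H s0); split=> [s Is|B0].
  rewrite polyE (deriv_within0_cst Iitv dH Is0 Is); exact: subrr.
have [_ mm _] := tmE Is0.
transitivity ((xc (alpha s0) + c1) ^+ 2 + (yc (alpha s0) + c2) ^+ 2).
  by rewrite /H /sphere_poly B0; ring.
rewrite XE// YE// B0; transitivity (A ^+ 2 * isodot (m s0) (m s0)).
  by rewrite /isodot; ring.
by rewrite mm mulr1.
Qed.

End SphericalCurves.

(** * From the Frenet frame to the RM frame *)

(** The derivatives t, a, j of the curve are kept abstract here, so that algebraic
    normalization does not unfold the limits that define them. *)
Section FrenetFrame.
Variable R : realType.
Variables (I : set R) (t a j : R -> 'rV[R]_3).
Hypothesis hI : nondegenerate_interval I.
Hypothesis dt : forall s, I s -> deriv_within I t s (a s).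
Hypothesis da : forall s, I s -> deriv_within I a s (j s).
Hypothesis dj : forall s, I s -> exists l, deriv_within I j s l.
Hypothesis tt : forall s, I s -> isodot (t s) (t s) = 1.
Hypothesis hdet : forall s, I s ->
  xc (t s) * yc (a s) - xc (a s) * yc (t s) != 0.

Let k s := isonorm (a s).
Let n s := (k s)^-1 *: a s.

Let ta s (Is : I s) : isodot (t s) (a s) = 0.
Proof.
have [tx ty tz] := deriv_within_xyz (dt Is).
have : 2 * isodot (t s) (a s) = 0.
  apply: (deriv_within_const_eq0 hI Is tt); rewrite /isodot.
  by apply: deriv_within_eq; [deriv_within_rules|rewrite /=; ring].
by move/eqP; rewrite mulf_eq0 pnatr_eq0/= => /eqP.
Qed.

Let aa_gt0 s (Is : I s) : 0 < isodot (a s) (a s).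
Proof.
rewrite lt_neqAle eq_sym andbC /isodot -!expr2 addr_ge0 ?sqr_ge0//=.
apply: contra (hdet Is); rewrite paddr_eq0 ?sqr_ge0// !sqrf_eq0.
by move=> /andP[/eqP ax /eqP ay]; rewrite ax ay mulr0 mul0r subrr.
Qed.

Let k_gt0 s (Is : I s) : 0 < k s.
Proof. by rewrite sqrtr_gt0 aa_gt0. Qed.

Let k_neq0 s (Is : I s) : k s != 0.
Proof. by rewrite gt_eqF// k_gt0. Qed.

Let kk s (Is : I s) : k s ^+ 2 = isodot (a s) (a s).
Proof. by rewrite sqr_sqrtr// ltW// aa_gt0. Qed.

Let k' s := (2 * k s)^-1 * (2 * isodot (a s) (j s)).

Let dk s (Is : I s) : deriv_within I k s (k' s).
Proof.
have [ax ay az] := deriv_within_xyz (da Is).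
apply: deriv_within_sqrt; first exact: aa_gt0.
by apply: deriv_within_eq; [rewrite /isodot; deriv_within_rules|
  rewrite /= /isodot; ring].
Qed.

Let n' s := (- k s ^- 2 * k' s) *: a s + (k s)^-1 *: j s.

Let dn s (Is : I s) : deriv_within I n s (n' s).
Proof.
apply: deriv_withinZ (da Is); apply: deriv_withinV (dk Is); exact: k_neq0.
Qed.

Let tau s := zc (n' s + k s *: t s).

Let dtau s (Is : I s) : exists l, deriv_within I tau s l.
Proof.
have [l jl] := dj Is.
have [tx ty tz] := deriv_within_xyz (dt Is).
have [ax ay az] := deriv_within_xyz (da Is).
have [jx jy jz] := deriv_within_xyz jl.
have ks := dk Is; have kV := deriv_withinV (k_neq0 Is) ks.
eexists; apply: (@eq_deriv_within _ _ _ _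
  (fun y => (-1 * ((k y)^-1 * (k y)^-1) * ((k y)^-1 *
     (xc (a y) * xc (j y) + yc (a y) * yc (j y)))) * zc (a y)
     + (k y)^-1 * zc (j y) + k y * zc (t y))) => //.
  move=> y; rewrite inE => Iy; rewrite /tau /n' /k' !coordE /isodot.
  by have := k_neq0 Iy; move: (k y) => ky ky0; field.
by deriv_within_rules.
Qed.

Let nn s (Is : I s) : isodot (n s) (n s) = 1.
Proof.
transitivity ((k s)^-1 ^+ 2 * isodot (a s) (a s)).
  by rewrite /isodot /n !coordE; ring.
by rewrite -kk// -exprMn mulVf ?expr1n// k_neq0.
Qed.

Let tn s (Is : I s) : isodot (t s) (n s) = 0.
Proof.
transitivity ((k s)^-1 * isodot (t s) (a s)).
  by rewrite /isodot /n !coordE; ring.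
by rewrite ta// mulr0.
Qed.

Let aE s (Is : I s) : a s = k s *: n s.
Proof. by rewrite /n scalerA divff ?scale1r// k_neq0. Qed.

(** Horizontally, (t, n) is orthonormal; <n, n> = 1 and <t, n> = 0 differentiate
    to <n, n'> = 0 and <t, n'> = - k, which are the two components of n'. *)
Let n'E s (Is : I s) : n' s = - k s *: t s + tau s *: ez R.
Proof.
have [tx ty tz] := deriv_within_xyz (dt Is).
have [nx ny nz] := deriv_within_xyz (dn Is).
have nn' : isodot (n s) (n' s) = 0.
  have : 2 * isodot (n s) (n' s) = 0.
    apply: (deriv_within_const_eq0 hI Is nn); rewrite /isodot.
    by apply: deriv_within_eq; [deriv_within_rules|rewrite /=; ring].
  by move/eqP; rewrite mulf_eq0 pnatr_eq0/= => /eqP.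
have tn' : isodot (t s) (n' s) = - k s.
  have : k s * isodot (n s) (n s) + isodot (t s) (n' s) = 0.
    apply: (deriv_within_const_eq0 hI Is tn); rewrite /isodot.
    apply: deriv_within_eq; first by deriv_within_rules.
    by rewrite aE// !coordE; ring.
  by rewrite nn// mulr1 addrC => /eqP; rewrite addr_eq0 => /eqP.
have [d [d1 nxE nyE]] := orthonormal_plane (tt Is) (nn Is) (tn Is).
have t1 := tt Is; rewrite /isodot in t1.
move: nn' tn'; rewrite /isodot nxE nyE => nn' tn'.
have {}nn' : - yc (t s) * xc (n' s) + xc (t s) * yc (n' s) = 0.
  transitivity (d * (d * - yc (t s) * xc (n' s) + d * xc (t s) * yc (n' s))).
    by rewrite -[LHS]mul1r -d1; ring.
  by rewrite nn' mulr0.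
have xE : xc (n' s) = - k s * xc (t s).
  rewrite -tn' -[LHS]mul1r -t1 -[RHS]addr0 -(mulr0 (- yc (t s))) -nn'; ring.
have yE : yc (n' s) = - k s * yc (t s).
  rewrite -tn' -[LHS]mul1r -t1 -[RHS]addr0 -(mulr0 (xc (t s))) -nn'; ring.
rewrite [LHS]point3_eta [RHS]point3_eta; congr point3.
- by rewrite xE !coordE; ring.
- by rewrite yE !coordE; ring.
- by rewrite /tau !coordE; ring.
Qed.

(** In the last equation the coefficient of ez is the torsion; it is differentiable
    since it involves no derivative of the curve beyond the third. *)
Lemma frenet_equations : exists nd : R -> 'rV[R]_3, forall s, I s ->
  [/\ 0 < k s, a s = k s *: n s & isotropic_orthonormal (t s) (n s)] /\
  [/\ deriv_within I n s (nd s),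
    nd s = - k s *: t s + zc (nd s + k s *: t s) *: ez R &
    exists l, deriv_within I (fun s => zc (nd s + k s *: t s)) s l].
Proof.
exists n' => s Is; split.
  by split; [exact: k_gt0|exact: aE|split; [exact: tt|exact: nn|exact: tn]].
by split; [exact: dn|exact: n'E|exact: dtau].
Qed.

End FrenetFrame.

Section RotationMinimizingFrame.
Variable R : realType.
Variables (I : set R) (alpha : R -> 'rV[R]_3).
Hypothesis hI : nondegenerate_interval I.
Hypothesis hC4 : Cn_on I 4 alpha.
Hypothesis hunit : unit_speed I alpha.
Hypothesis hdet : forall s, I s ->
  xc (tangent I alpha s) * yc (acceleration I alpha s)
  - xc (acceleration I alpha s) * yc (tangent I alpha s) != 0.

Let t := tangent I alpha.
Let a := acceleration I alpha.
Let k := curvature I alpha.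
Let n := normal I alpha.

Let tt s (Is : I s) : isodot (t s) (t s) = 1.
Proof.
have := hunit Is; rewrite /isonorm => tt1.
rewrite -[LHS]sqr_sqrtr ?tt1 ?expr1n//.
by rewrite /isodot -!expr2 addr_ge0// sqr_ge0.
Qed.

Lemma frenet_frame :
  (forall s, I s -> [/\ 0 < k s, a s = k s *: n s,
    isotropic_orthonormal (t s) (n s) &
    deriv_within I n s (- k s *: t s + torsion I alpha s *: ez R)]) /\
  {within I, continuous (torsion I alpha)}.
Proof.
have dt s : I s -> deriv_within I t s (a s).
  exact: (derivable_on_deriv_within (f := t) (hC4.1 1%N isT)).
have da s : I s -> deriv_within I a s (derive_on I a s).
  exact: (derivable_on_deriv_within (f := a) (hC4.1 2%N isT)).
have dj s : I s -> exists l, deriv_within I (derive_on I a) s l.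
  exists (derive_on I (derive_on I a) s).
  exact: (derivable_on_deriv_within (f := derive_on I a) (hC4.1 3%N isT)).
have [n1 H] := frenet_equations hI dt da dj tt hdet.
have torsionE s : I s -> torsion I alpha s = zc (n1 s + k s *: t s).
  by move=> Is; have [_ [/(deriv_within_derive_on hI Is) <-]] := H s Is.
split=> [s Is|].
  have [[k0 aE tn] [dn n1E _]] := H s Is; split => //.
  by rewrite torsionE// -n1E.
apply: deriv_within_continuous => s Is; have [_ [_ _ [l dl]]] := H s Is.
exists l; apply: eq_deriv_within dl => // y; rewrite inE; exact: torsionE.
Qed.

Lemma curvature_gt0 s : I s -> 0 < curvature I alpha s.
Proof. by move=> /frenet_frame.1[]. Qed.

(** Subtracting theta ez from n removes exactly the torsion term of n', because
    theta' is the torsion; the horizontal parts, hence the products, do not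
    change. *)
Lemma rm_frame_equations s0 tau0 : I s0 ->
  rm_equations I alpha t (fun s => n s - theta I alpha s0 tau0 s *: ez R)
    k (fun s => k s * theta I alpha s0 tau0 s) /\
  (forall s, I s ->
    isotropic_orthonormal (t s) (n s - theta I alpha s0 tau0 s *: ez R)).
Proof.
have [frame torsion_continuous] := frenet_frame.
move=> Is0; set th := theta I alpha s0 tau0; split=> s Is;
  have [_ aE [tt1 nn tn] dn] := frame s Is; last first.
  by split; [exact: tt| rewrite -nn| rewrite -tn];
    rewrite /isodot -scaleNr !coordE; ring.
split.
- exact: (derivable_on_deriv_within (f := alpha) (hC4.1 0%N isT) Is).
- apply: deriv_within_eq.
    exact: (derivable_on_deriv_within (f := t) (hC4.1 1%N isT) Is).
  by rewrite -[LHS]/(a s) aE /= scalerBr [k s *: (_ *: ez R)]scalerA subrK.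
- have dth : deriv_within I (fun y => - th y) s (- torsion I alpha s).
    have := deriv_withinM (deriv_within_cst I (-1 : R) s) (deriv_withinD
      (oriented_integral_deriv hI.1 torsion_continuous Is0 Is)
      (deriv_within_cst I tau0 s)).
    rewrite mul0r add0r addr0 mulN1r; apply: eq_deriv_within => // y _.
    by rewrite mulN1r.
  have := deriv_withinD dn (deriv_withinZ dth (deriv_within_cst I (ez R) s)).
  rewrite scaler0 addr0 [- torsion _ _ _ *: _]scaleNr addrK.
  by apply: eq_deriv_within => // y _; rewrite scaleNr.
Qed.

End RotationMinimizingFrame.

(** * Spherical curves and their normal developments *)

Theorem theorem5p1 (R : realType) (I : set R) (alpha : R -> 'rV[R]_3)
    (n1 n2 : R -> 'rV[R]_3) (kappa1 kappa2 : R -> R)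
    (hI : nondegenerate_interval I)
    (hC4 : Cn_on I 4 alpha)
    (hreg : regular_curve I alpha)
    (hunit : unit_speed I alpha)
    (hadm : admissible I alpha)
    (hRM : rm_frame I alpha n1 n2 kappa1 kappa2) :
  ((exists S : set 'rV[R]_3,
      iso_sphere S /\ (forall s, I s -> S (alpha s))) <->
   (exists L : set (R * R),
      [/\ plane_line L, ~ L (0, 0)
        & forall s, I s -> L (kappa1 s, kappa2 s)])) /\
  (forall r : R, 0 < r ->
     (exists S : set 'rV[R]_3,
        cylindrical_sphere r S /\ (forall s, I s -> S (alpha s))) <->
     (forall s, I s -> curvature I alpha s = r^-1)).
Proof.
have [s0 [tau0 [Is0 hk]]] := hRM.
have [rmE tmE] := rm_frame_equations hI hC4 hunit hadm.2 tau0 Is0.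
have k1E s : I s -> kappa1 s = curvature I alpha s by move=> /hk[].
have k2E s : I s -> kappa2 s = curvature I alpha s * theta I alpha s0 tau0 s.
  by move=> /hk[].
split; [split|move=> r r0; split].
- move=> [S [[c1 [c2 [c3 [c4 [-> _ _ _]]]]] onS]].
  have [C CE] := spherical_normal_development hI rmE tmE onS.
  have lineE s : I s -> C * kappa1 s + c3 * kappa2 s = -1.
    by move=> Is; rewrite k1E// k2E//; have [] := CE s Is.
  exists [set q | C * q.1 + c3 * q.2 = -1]; split.
  + exists C, c3, (-1); split => //; apply/eqP => -[C0 c30].
    by have := lineE s0 Is0; rewrite C0 c30 !mul0r addr0; lra.
  + by rewrite /= !mulr0 addr0; lra.
  + exact: lineE.
- move=> [L [[a [b [c [_ ->]]]] /= n0 onL]].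
  have c0 : c != 0 by apply/eqP => c0; apply: n0; rewrite c0 !mulr0 addr0.
  have lineE s : I s -> (- a / c) * curvature I alpha s +
      (- b / c) * (curvature I alpha s * theta I alpha s0 tau0 s) = -1.
    move=> Is; transitivity (- (a * kappa1 s + b * kappa2 s) / c).
      by rewrite k1E// k2E//; ring.
    by rewrite (onL s Is) mulNr divff.
  have [c1 [c2 [c4 [sph cyl]]]] :=
    spherical_of_normal_development hI rmE tmE lineE.
  exists [set p | sphere_poly c1 c2 (- b / c) c4 p = 0].
  have [b0|bn0] := eqVneq (- b / c) 0; last first.
    by split; [exact: graph_iso_sphere|exact: sph].
  have an0 : - a / c != 0.
    apply/eqP => a0; have := lineE s0 Is0; rewrite a0 b0 !mul0r addr0; lra.
  split; last exact: sph; rewrite b0.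
  apply: (@cylinder_iso_sphere _ _ _ _ `|- a / c|); first by rewrite normr_gt0.
  by rewrite cyl// real_normK// num_real.
- move=> [S [[P ->] onS]] s Is.
  have sph y : I y -> sphere_poly (- xc P) (- yc P) 0
      (xc P ^+ 2 + yc P ^+ 2 - r ^+ 2) (alpha y) = 0.
    move=> /onS /= <-; rewrite /sphere_poly /isodot /xc /yc !mxE; ring.
  have [C /(_ s Is)[Ck CE]] := spherical_normal_development hI rmE tmE sph.
  have {}CE : C ^+ 2 = r ^+ 2.
    by rewrite -CE// -(onS s Is) /isodot /xc /yc !mxE; ring.
  have k0 := curvature_gt0 hI hC4 hunit hadm.2 Is.
  have : (curvature I alpha s * r) ^+ 2 = 1.
    rewrite exprMn -CE -exprMn mulrC; move: Ck; rewrite mul0r addr0 => ->.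
    by rewrite sqrrN expr1n.
  move/eqP; rewrite sqrf_eq1 => /orP[/eqP kr|/eqP kr].
    by rewrite -[LHS](mulfK (lt0r_neq0 r0)) kr mul1r.
  by have := mulr_gt0 k0 r0; rewrite kr; lra.
- move=> kr; have lineE s : I s -> (- r) * curvature I alpha s +
      0 * (curvature I alpha s * theta I alpha s0 tau0 s) = -1.
    by move=> Is; rewrite kr// mul0r addr0 mulNr divff// gt_eqF.
  have [c1 [c2 [c4 [sph /(_ erefl) cyl]]]] :=
    spherical_of_normal_development hI rmE tmE lineE.
  have [P [Px Py]] : exists P : 'rV[R]_3, xc P = - c1 /\ yc P = - c2.
    by exists (point3 (- c1) (- c2) 0); rewrite xc_point3 yc_point3.
  exists [set p | isodot (p - P) (p - P) = r ^+ 2]; split; first by exists P.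
  move=> s /sph /=; rewrite sqrrN in cyl; rewrite -cyl /sphere_poly /isodot.
  by rewrite -scaleN1r !coordE Px Py; lra.
Qed.
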